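(* Let $a$, $p_i$ ($i\in\mathbb{Z}$) and $q_j$ ($j\in\mathbb{Z}$) be indeterminates and let $(r,c,n) \in \mathbb{Z}_{\ge 0}^{3}$. Then $$\sum_{\pi \in \mathcal{P}(r,c,n)} a^{\mathsf{tr}_{0}(\pi)} \left( \prod_{i=1}^{r-1} p_{i}^{\mathsf{tr}_{-i}(\pi)} \right) \left( \prod_{j=1}^{c-1} q_{j}^{\mathsf{tr}_{j}(\pi)} \right) \omega_{r,n}(\pi;a;\mathbf{p},\mathbf{q}) = \prod_{i=0}^{r-1} \prod_{j=0}^{c-1} \prod_{k=0}^{n-1} \frac{1 - a \mathbf{p}^{\overline{i}} \mathbf{q}^{\overline{j+k+1}}}{1 - a \mathbf{p}^{\overline{i}} \mathbf{q}^{\overline{j+k}}},$$ where $$\omega_{r,n}(\pi;a;\mathbf{p},\mathbf{q}) = \prod_{k=1}^{\pi_{1,1}} \left\{ \prod_{i=1}^{D_k} \left(1 - \mathbf{q}_{\lambda_{k,i}(\pi)-i}^{\overline{n-k+i}}\right) \right\} \left\{ \prod_{i=D_k+1}^{r} \left(1 - a \mathbf{p}^{\overline{i-\lambda_{k,i}(\pi)-1}} \mathbf{q}^{\overline{n-k+\lambda_{k,i}(\pi)}}\right) \right\} \left\{ \prod_{i=1}^{r} \left(1 - a \mathbf{p}^{\overline{i-1}} \mathbf{q}^{\overline{n-k}}\right) \right\}^{-1},$$ $\pi_{1,1}$ denotes the $(1,1)$-part of the plane partition $\pi$, and $D_k = \mathsf{D}(\lambda_k(\pi))$.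
   Context: A plane partition is an array $\pi=(\pi_{i,j})_{i,j\ge 1}$ of nonnegative integers with finite sum such that $\pi_{i,j}\ge \max\{\pi_{i+1,j},\pi_{i,j+1}\}$ for all $i,j \ge 1$. For $\ell\in\mathbb{Z}$ its $\ell$-trace is $\mathsf{tr}_\ell(\pi)=\sum_{j-i=\ell}\pi_{i,j}$. $\mathcal{P}(r,c,n)$ is the set of plane partitions with at most $r$ rows, at most $c$ columns and parts at most $n$, i.e. $\pi_{i,j}=0$ whenever $i>r$ or $j>c$, and $\pi_{1,1}\le n$. For $k\ge 1$, $\lambda_k(\pi)$ is the (integer) partition whose $i$-th part $\lambda_{k,i}(\pi)$ is the number of parts in the $i$-th row of $\pi$ that are at least $k$, i.e. $\lambda_{k,i}(\pi)=\#\{j\ge1 : \pi_{i,j}\ge k\}$. For a partition $\lambda$, $\mathsf{D}(\lambda)=\#\{i\ge 1:\lambda_i\ge i\}$ is the size of the Durfee square of $\lambda$. Write $\mathbf{p}=(\dots,p_{-1},p_0,p_1,\dots)$ and $\mathbf{q}=(\dots,q_{-1},q_0,q_1,\dots)$. For a bilateral sequence $\mathbf{x}=(x_k)_{k\in\mathbb{Z}}$ and $m\in\mathbb{Z}$, $\mathbf{x}^{\overline{m}}=\prod_{k=1}^{m}x_k$ if $m>0$, $\mathbf{x}^{\overline{0}}=1$, and $\mathbf{x}^{\overline{m}}=\prod_{k=m+1}^{0}x_k^{-1}$ if $m<0$. $\mathbf{x}_s$ denotes the $s$-shifted sequence whose $k$-th entry is $x_{s+k}$, so e.g. $\mathbf{q}_s^{\overline{m}}=q_{s+1}q_{s+2}\cdots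 q_{s+m}$ for $m>0$. The identity is in the field of rational functions over $\mathbb{C}$ in the indeterminates. Empty products equal $1$. *)

(* Defs.v *)
From HB Require Import structures.
From mathcomp Require Import all_boot all_order all_algebra.
From mathcomp Require Import finmap.
From mathcomp.multinomials Require Import monalg.
From mathcomp Require Import zify.
Set Implicit Arguments.
Unset Strict Implicit.
Unset Printing Implicit Defensive.
Import Order.TTheory GRing.Theory Num.Theory.
Local Open Scope ring_scope.

(* Polynomials over an integral domain in countably many indeterminates form
   an integral domain: monalg only provides the commutative algebra structure.
   The Kronecker substitution X_i := 'X^(B ^ choice.pickle i) reduces this to {poly R}. *)
Section MalgIdomain.
Context (I : countType) (R : idomainType).
Implicit Types (m : {cmonom I}) (g p q : {malg R[{cmonom I}]}) (B : nat).

Let kr_wt B m : nat := (\sum_(i <- finsupp m) m i * B ^ choice.pickle i)%N.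

Let kr_wtEw B (d : {fset I}) m : (finsupp m `<=` d)%fset ->
  kr_wt B m = (\sum_(i <- d) m i * B ^ choice.pickle i)%N.
Proof.
move=> le; rewrite /kr_wt (big_fset_incl _ le) // => i _.
by rewrite -cmE_neq0 negbK => /eqP->.
Qed.

Let kr_wt1 B : kr_wt B mone = 0%N.
Proof. by rewrite /kr_wt mdom1 big_seq_fset0. Qed.

Let kr_wtM B : {morph kr_wt B : m1 m2 / mmul m1 m2 >-> (m1 + m2)%N}.
Proof.
move=> m1 m2; rewrite /kr_wt mdomD -!/(kr_wt B _).
rewrite (kr_wtEw B (fsubsetUl _ (finsupp m2))).
rewrite (kr_wtEw B (fsubsetUr (finsupp m1) _)) -big_split /=.
by apply: eq_bigr => i _; rewrite cmM mulnDl.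
Qed.

Let digits_inj B N (a b : nat -> nat) :
    (forall k, a k < B)%N -> (forall k, b k < B)%N ->
    (\sum_(k < N) a k * B ^ k = \sum_(k < N) b k * B ^ k)%N ->
  forall k, (k < N)%N -> a k = b k.
Proof.
elim: N a b => // N IHN a b aB bB.
rewrite !big_ord_recl /= !expn0 !muln1.
have split_sum (u : nat -> nat) : (\sum_(i < N) u (bump 0 i) * B ^ bump 0 i
    = (\sum_(i < N) u i.+1 * B ^ i) * B)%N.
  rewrite big_distrl /=; apply: eq_bigr => i _.
  by rewrite /bump /= add1n expnSr mulnA.
rewrite !split_sum => eqab.
have B0 : (0 < B)%N by apply: leq_ltn_trans (aB 0%N).
have e0 : a 0%N = b 0%N.
  by have := congr1 (modn^~ B) eqab; rewrite /= addnC modnMDl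
    addnC modnMDl !modn_small.
case=> [_|k /= kN]; first exact: e0.
apply: (IHN (fun k => a k.+1) (fun k => b k.+1)) => //.
by move: eqab; rewrite e0 => /addnI/eqP; rewrite eqn_pmul2r // => /eqP.
Qed.

Let kr_wtE B m N : (forall i, i \in finsupp m -> choice.pickle i < N)%N ->
  kr_wt B m = (\sum_(k < N) oapp m 0%N (@choice.pickle_inv I k) * B ^ k)%N.
Proof.
move=> mN; transitivity (\sum_(i <- finsupp m) \sum_(k < N | choice.pickle i == k)
    m i * B ^ k)%N.
  rewrite /kr_wt big_seq [RHS]big_seq; apply: eq_bigr => i im.
  by rewrite (big_pred1 (Ordinal (mN i im))) // => k; rewrite eq_sym.
rewrite (exchange_big_dep xpredT) //=; apply: eq_bigr => k _.
case Ek: (@choice.pickle_inv I k) => [j|] /=; last first.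
  rewrite big1 // => i /eqP ik.
  by rewrite -ik choice.pickleK_inv in Ek.
have jk : choice.pickle j = k by have := @choice.pickle_invK I k; rewrite /= Ek.
rewrite -big_filter (eq_filter (a2 := pred1 j)) => [|i]; last first.
  by rewrite /= -jk (inj_eq (pcan_inj (@choice.pickleK I))).
case: (mdomP m j) => [jm|jm]; first by rewrite filter_pred1_uniq ?fset_uniq // big_seq1.
by rewrite mul0n big_filter big1_seq // => i /andP[/eqP->]; rewrite (negbTE jm).
Qed.

Let kr_wt_inj B m1 m2 : (forall i, m1 i < B)%N -> (forall i, m2 i < B)%N ->
  kr_wt B m1 = kr_wt B m2 -> m1 = m2.
Proof.
move=> m1B m2B.
pose d := (finsupp m1 `|` finsupp m2)%fset.
pose N := (\max_(i <- d) (choice.pickle i).+1)%N.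
have ltN i : i \in d -> (choice.pickle i < N)%N.
  by move=> id; rewrite /N (big_fsetD1 i) //= leq_max leqnn.
rewrite (@kr_wtE _ _ N) => [|i im]; last by rewrite ltN // in_fsetU im.
rewrite (@kr_wtE _ _ N) => [|i im]; last by rewrite ltN // in_fsetU im orbT.
have B0 (i : I) : (0 < B)%N by apply: leq_ltn_trans (m1B i).
move=> eqw; apply/eqP/cmP => i.
have [id|] := boolP (i \in d); last first.
  by rewrite in_fsetU negb_or -!cmE_eq0 => /andP[/eqP-> /eqP->].
have bnd (m : {cmonom I}) k : (forall i, m i < B)%N ->
    (oapp m 0%N (@choice.pickle_inv I k) < B)%N.
  by move=> mB; case: (@choice.pickle_inv I k) => [j|] /=; [exact: mB|exact: B0 i].
have := digits_inj (bnd m1 ^~ m1B) (bnd m2 ^~ m2B) eqw (ltN i id).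
by rewrite choice.pickleK_inv.
Qed.

Let kr B g : {poly R} := mmap (@polyC R) (fun m => 'X^(kr_wt B m)) g.

Let krM B : {morph kr B : p q / p * q}.
Proof.
pose h m : {poly R} := 'X^(kr_wt B m).
pose hB := isMultiplicative.Build _ _ h
  (pair (fun m1 m2 => etrans (congr1 _ (kr_wtM B m1 m2)) (exprD _ _ _))
        (etrans (congr1 _ (kr_wt1 B)) (expr0 _))).
pose hM : {mmorphism {cmonom I} -> {poly R}} := HB.pack h hB.
exact: (rmorphM (mmap (@polyC R) hM)).
Qed.

Let mB B g : (msize g <= B)%N -> forall m, m \in msupp g -> forall i, (m i < B)%N.
Proof.
move=> gB m mg i; apply: leq_trans gB; apply: leq_trans (msize_mdeg_lt mg).
by rewrite ltnS mdegE; case: mdomP => // im; rewrite (big_fsetD1 i) //= leq_addr.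
Qed.

Let coef_kr B g m : (msize g <= B)%N -> m \in msupp g ->
  (kr B g)`_(kr_wt B m) = g@_m.
Proof.
move=> gB mg; rewrite /kr mmapE coef_sum (big_fsetD1 m) //=.
rewrite coefCM coefXn eqxx mulr1 big_seq big1 ?addr0 // => k.
rewrite in_fsetD1 => /andP[nkm kg]; rewrite coefCM coefXn.
case: eqP => [/kr_wt_inj e|]; last by rewrite mulr0.
by rewrite e ?eqxx // in nkm; apply: mB gB _ _.
Qed.

Let kr_eq0 B g : (msize g <= B)%N -> kr B g = 0 -> g = 0.
Proof.
move=> gB g0; apply/malgP => m; rewrite mcoeff0.
by case: msuppP => // mg; rewrite -(coef_kr gB mg) g0 coef0.
Qed.

Fact malg_integral p q : p * q = 0 -> (p == 0) || (q == 0).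
Proof.
move=> pq0; pose B := maxn (msize p) (msize q).
have /eqP : kr B p * kr B q = 0 by rewrite -krM pq0 /kr raddf0.
by rewrite mulf_eq0 => /orP[] /eqP/kr_eq0 ->; rewrite ?eqxx ?orbT ?leq_maxl ?leq_maxr.
Qed.

Definition malg_unit : pred {malg R[{cmonom I}]} :=
  fun p => (p == (p@_mone)%:MP) && (p@_mone \in GRing.unit).

Definition malg_inv p := if p \in malg_unit then (p@_mone)^-1%:MP else p.

Fact malg_mulVp : {in malg_unit, left_inverse 1 malg_inv *%R}.
Proof.
move=> p Up; rewrite /malg_inv Up; case/andP: Up.
by move/eqP=> {3}-> ?; rewrite -mpolyCM mulVr.
Qed.

Fact malg_intro_unit p q : q * p = 1 -> p \in malg_unit.
Proof.
move=> qp1; apply/andP; split; last first.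
  by apply/unitrPr; exists q@_mone; rewrite mulrC -rmorphM qp1 rmorph1.
pose B := msize p.
have krp : size (kr B p) = 1%N.
  have e : kr B q * kr B p = 1.
    by rewrite -krM qp1 /kr -mpolyC1E mmapU kr_wt1 expr0 mulr1.
  apply/eqP.
  have := size_poly1 R; rewrite -e.
  have [->|nzp] := eqVneq (kr B p) 0; first by rewrite mulr0 size_poly0.
  have [->|nzq] := eqVneq (kr B q) 0; first by rewrite mul0r size_poly0.
  rewrite size_mul //; move: nzp nzq; rewrite -!size_poly_gt0; lia.
apply/eqP/malgP => m; rewrite mcoeffC.
have [->|nm1] := eqVneq m mone; first by rewrite mulr1n.
rewrite mulr0n; case: msuppP => // mp.
rewrite -(coef_kr (leqnn _) mp) nth_default // krp lt0n.
apply: contraNN nm1 => /eqP w0; apply/eqP; apply: (@kr_wt_inj B).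
- exact: mB mp.
- by move=> i; rewrite cm1; apply: leq_ltn_trans (mB (leqnn _) mp i).
- by rewrite kr_wt1.
Qed.

Fact malg_inv_out : {in [predC malg_unit], malg_inv =1 id}.
Proof. by rewrite /malg_inv => p /negbTE /= ->. Qed.

HB.instance Definition _ := GRing.ComNzRing_hasMulInverse.Build
  (malg (cmonom I) R) malg_mulVp malg_intro_unit malg_inv_out.
HB.instance Definition _ := GRing.ComUnitRing_isIntegral.Build
  (malg (cmonom I) R) malg_integral.

End MalgIdomain.

Inductive indet := IndA | IndP of int | IndQ of int.

Definition indet_code (x : indet) : option (int + int) :=
  match x with IndA => None | IndP i => Some (inl i) | IndQ j => Some (inr j) end.
Definition indet_decode (x : option (int + int)) : indet :=
  match x with None => IndA | Some (inl i) => IndP i | Some (inr j) => IndQ j end.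
Fact indet_codeK : cancel indet_code indet_decode. Proof. by case. Qed.
HB.instance Definition _ := Countable.copy indet (can_type indet_codeK).

(* The field of rational functions over F in the indeterminates a, p_i, q_j
   (i, j in Z). *)
Definition ratfun (F : fieldType) : fieldType :=
  {fraction {malg F[{cmonom indet}]}}.

Definition ind (F : fieldType) (x : indet) : ratfun F :=
  FracField.tofrac (<< ucm x >> : {malg F[{cmonom indet}]}).

Section BilateralSequences.
Context (K : fieldType).
Implicit Type x : int -> K.

(* The m-th "rising power" of x; note Negz m = - m.+1, for which the product
   of the inverses ranges over the indices - m, ..., -1, 0. *)
Definition bipow x (m : int) : K :=
  match m with
  | Posz m => \prod_(1 <= k < m.+1) x k%:Z
  | Negz m => \prod_(0 <= k < m.+1) (x (- k%:Z))^-1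
  end.

Definition bishift (s : int) x : int -> K := fun k => x (s + k).

End BilateralSequences.

(* Integer partitions are sequences of parts, extended by zeros; parts are
   numbered from 1. *)
Definition part (la : seq nat) (i : nat) : nat := nth 0%N la i.-1.

Definition durfee (la : seq nat) : nat :=
  count (fun i => i <= part la i)%N (iota 1 (size la)).

(* Arrays are indexed by (i, j) with i, j >= 1; the values at i = 0 or j = 0
   are irrelevant. An array of natural numbers has finite sum iff it has finite
   support. *)
Definition plane_partition (pi : nat -> nat -> nat) : Prop :=
  (exists N, forall i j, 0 < i -> 0 < j -> N < i + j -> pi i j = 0)%N /\
  (forall i j, 0 < i -> 0 < j -> maxn (pi i.+1 j) (pi i j.+1) <= pi i j)%N.

Definition plane_partition_in_box (r c n : nat) (pi : nat -> nat -> nat) : Prop :=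
  [/\ plane_partition pi,
      (forall i j, 0 < i -> 0 < j -> (r < i) || (c < j) -> pi i j = 0)%N
    & (pi 1 1 <= n)%N].

Section PlanePartitions.
Context (r c n : nat).

Definition box := {ffun 'I_r * 'I_c -> 'I_n.+1}.

Implicit Type f : box.

(* The 1-based extension by zero of f to an infinite array. *)
Definition entry f (i j : nat) : nat :=
  match i, j with
  | i'.+1, j'.+1 =>
      match insub i', insub j' with
      | Some x, Some y => f (x, y)
      | _, _ => 0
      end
  | _, _ => 0
  end.

(* The set P(r, c, n): see PPP and entry_inj below. *)
Definition PP : {set box} :=
  [set f : box | [forall i : 'I_r, forall j : 'I_c,
    maxn (entry f i.+2 j.+1) (entry f i.+1 j.+2) <= entry f i.+1 j.+1]%N].

Lemma entry_ord f (i : 'I_r) (j : 'I_c) : entry f i.+1 j.+1 = f (i, j).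
Proof. by rewrite /entry !valK. Qed.

Lemma entry_out f i j : (r < i)%N || (c < j)%N -> entry f i j = 0%N.
Proof.
case: i j => [|i] [|j] //=; rewrite !ltnS => /orP[ri|cj].
  by rewrite insubN // -leqNgt.
by rewrite [insub j]insubN -?leqNgt //; case: insub.
Qed.

Lemma entry_le f i j : (entry f i j <= n)%N.
Proof.
case: i j => [|i] [|j] //=; case: insub => [x|] //; case: insub => [y|] //.
by rewrite -ltnS.
Qed.

Lemma entry_inj f g :
  (forall i j, 0 < i -> 0 < j -> entry f i j = entry g i j)%N -> f = g.
Proof.
move=> fg; apply/ffunP => -[i j]; apply: val_inj => /=.
by rewrite -!entry_ord fg.
Qed.

Lemma plane_partition_max pi : plane_partition pi ->
  forall i j, (pi i.+1 j.+1 <= pi 1%N 1%N)%N.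
Proof.
move=> [_ dec]; have row i : (pi i.+1 1%N <= pi 1%N 1%N)%N.
  elim: i => // i IHi; apply: leq_trans IHi.
  by have := dec i.+1 1%N isT isT; rewrite geq_max => /andP[].
move=> i; elim=> [|j IHj]; first exact: row.
apply: leq_trans IHj.
by have := dec i.+1 j.+1 isT isT; rewrite geq_max => /andP[].
Qed.

Lemma PPP (pi : nat -> nat -> nat) :
  plane_partition_in_box r c n pi <->
  exists2 f, f \in PP &
    (forall i j, 0 < i -> 0 < j -> pi i j = entry f i j)%N.
Proof.
split=> [[pipp piout pin]|[f]].
  pose f : box := [ffun x : 'I_r * 'I_c => inord (pi x.1.+1 x.2.+1)].
  have fE i j : (0 < i)%N -> (0 < j)%N -> pi i j = entry f i j.
    case: i j => [//|i] [//|j] _ _.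
    have [out|] := boolP ((r < i.+1) || (c < j.+1))%N.
      by rewrite entry_out // piout.
    rewrite negb_or -!leqNgt => /andP[ir jc].
    rewrite (entry_ord f (Ordinal ir) (Ordinal jc)) ffunE inordK //= ltnS.
    exact: leq_trans (plane_partition_max pipp i j) pin.
  exists f => //; rewrite inE; apply/'forall_'forall_idP => i j.
  by rewrite -!fE //; apply: pipp.2.
rewrite inE => /'forall_'forall_idP fPP piE; split; last first.
- by rewrite piE // entry_le.
- by move=> i j i0 j0 out; rewrite piE // entry_out.
split.
  exists (r + c)%N => i j i0 j0 ij; rewrite piE // entry_out //.
  by rewrite -[_ || _]negbK negb_or -!leqNgt; apply/negP; lia.
move=> [//|i] [//|j] _ _; rewrite !piE //.
have [out|] := boolP ((r < i.+1) || (c < j.+1))%N.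
  by rewrite !entry_out ?maxnn //; lia.
rewrite negb_or -!leqNgt => /andP[ir jc].
exact: (fPP (Ordinal ir) (Ordinal jc)).
Qed.

Definition tr (l : int) f : nat :=
  (\sum_(1 <= i < r.+1) \sum_(1 <= j < c.+1 | (j%:Z - i%:Z == l)%R)
     entry f i j)%N.

Definition lam (k : nat) f : seq nat :=
  [seq count (fun j => k <= entry f i j)%N (iota 1 c) | i <- iota 1 r].

(* All exponents and shifts are computed in Z. *)
Definition omega (K : fieldType) (f : box) (a : K) (p q : int -> K) : K :=
  \prod_(1 <= k < (entry f 1 1).+1)
    let la i := part (lam k f) i in
    let D := durfee (lam k f) in
    (\prod_(1 <= i < D.+1)
       (1 - bipow (bishift ((la i)%:Z - i%:Z) q) (n%:Z - k%:Z + i%:Z))) *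
    (\prod_(D.+1 <= i < r.+1)
       (1 - a * bipow p (i%:Z - (la i)%:Z - 1)
              * bipow q (n%:Z - k%:Z + (la i)%:Z))) *
    (\prod_(1 <= i < r.+1)
       (1 - a * bipow p (i%:Z - 1) * bipow q (n%:Z - k%:Z)))^-1.

End PlanePartitions.

(* Main.v *)
Require Import Defs.
From mathcomp Require Import all_boot all_order all_algebra.
From mathcomp.multinomials Require Import monalg.
From mathcomp Require Import zify ring.
From mathcomp Require Import reals complex.
Import GRing.Theory.
Local Open Scope ring_scope.
Local Open Scope complex_scope.

(** The indeterminates are encoded in one potential h on the integers: h m is
    the rising power of q for m >= 0, and h (- i) = 1 / (a p_1 ... p_(i-1)) for
    i >= 1.  Then a, p_i and q_j are the ratios h t / h (t - 1) for t = 0,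
    t = - i and t = j, a row of length l in lambda_k has monomial weight
    h (l - i) / h (- i) by telescoping, and both kinds of factors in the
    numerator of omega become the single expression 1 - h (l + n - k) / h (l - i);
    the Durfee square only separates the rows with l >= i, where h (l - i) is a
    power of q, from the others.  So the summand at a plane partition f is
      prod_(i, k) (h (l - i) - h (l + n - k)) / (h (- i) - h (n - k))
    with l = lambda_(k,i) (lemma [weight_pot]).  The denominator does not depend
    on f, and the right-hand side telescopes in j, which leaves the polynomial
    identity [sum_numerators]:
      sum_f prod_(i, k) (h (l - i) - h (l + n - k))
        = prod_(i, k) (h (- i) - h (c + n - k)).

    This sum is a factorial Schur function of rectangular shape (n^r) in the
    variables x_t = h t, - r <= t < c.  Indeed, extend f by n to the columns
    j <= 0 and read it along its diagonals j - i = t: these are partitions that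
    decrease from (n^r) to the empty one by removing horizontal strips, and the
    factor of row i at level k belongs to the step t = l - i, the only one that
    removes box k from row i.  It equals x_t - h (t + n + i - k).

    The key is that the variables x may be permuted ([strip_sum_swap]): for two
    consecutive strips the intermediate partition varies in each row
    independently, and each row sum is symmetric up to forced boxes, which can
    be matched between neighbouring rows.  One may therefore move h 0, ...,
    h (c - 1) to the front.  There they are the parameters at which the first
    step from (n^r) cannot remove any box: it merely shifts the index t
    ([strip_sum_top]).  What remains are r steps from (n^r) to the empty
    partition, which must remove one full row each, so the sum is a single
    product ([strip_sum_rect]). *)

(** * Horizontal strips and the symmetry of their weighted sums *)

Section Strips.
Set Implicit Arguments.
Unset Strict Implicit.
Unset Printing Implicit Defensive.
Context (K : fieldType) (r n : nat) (h : int -> K).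
Local Notation diag := {ffun 'I_r -> 'I_n.+1}.
Implicit Types (d : diag) (t : int) (x : K) (xs : seq K).

(** Parts are numbered from 0 here; the parts from r on are 0, so that [hstrip]
    allows the last row to be emptied at once. *)
Definition dpart d (i : nat) : nat := if insub i is Some u then d u else 0%N.

Lemma dpart_ord d (i : 'I_r) : dpart d i = d i.
Proof. by rewrite /dpart valK. Qed.

Lemma dpart_out d i : (r <= i)%N -> dpart d i = 0%N.
Proof. by move=> ri; rewrite /dpart insubN // -leqNgt. Qed.

Lemma dpart_le d i : (dpart d i <= n)%N.
Proof. by rewrite /dpart; case: insub => // u; rewrite -ltnS. Qed.

Definition hstrip d d' := [forall i : 'I_r, dpart d i.+1 <= d' i <= d i]%N.

(** In the 0-based indexing, box k of row i removed at time t contributes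
    x - h (t + n + i - k). The parameter h depends on i - k and t only: this is
    the content shift of factorial Schur functions. *)
Definition strip_wt t x d d' : K :=
  \prod_(i < r) \prod_(d' i <= k < d i) (x - h (t + n%:Z + i%:Z - k%:Z)).

Definition dtop : diag := [ffun=> ord_max].
Definition dbot : diag := [ffun=> ord0].

(** The factorial Schur function of shape d, summed over the ways to empty d by
    one horizontal strip for each variable. *)
Fixpoint strip_sum xs t d : K :=
  if xs is x :: xs' then \sum_(d' | hstrip d d') strip_wt t x d d' * strip_sum xs' (t + 1) d'
  else (d == dbot)%:R.

(** The sum of one row over its free end m telescopes once multiplied by x - y,
    since (x - e m) - (y - e m) = x - y. *)
Lemma segment_sum_mulB (e : nat -> K) x y lo hi : (lo <= hi)%N ->
  (x - y) * (\sum_(lo <= m < hi.+1)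
     (\prod_(m <= k < hi) (x - e k.+1)) * \prod_(lo <= k < m) (y - e k))
  = \prod_(lo <= k < hi.+1) (x - e k) - \prod_(lo <= k < hi.+1) (y - e k).
Proof.
move=> lohi.
pose U m := (\prod_(m <= k < hi.+1) (x - e k)) * \prod_(lo <= k < m) (y - e k).
rewrite big_distrr /=.
rewrite (eq_big_nat _ _ (F2 := fun m => - (U m.+1 - U m))); last first.
  move=> m /andP[lom mhi]; rewrite /U.
  rewrite [\prod_(m <= k < hi.+1) _]big_ltn // [\prod_(lo <= k < m.+1) _]big_nat_recr //=.
  rewrite big_add1 /=; ring.
rewrite sumrN telescope_sumr 1?leqW // opprB /U.
by rewrite [\prod_(lo <= k < lo) _]big_geq // [\prod_(hi.+1 <= k < _) _]big_geq // mulr1 mul1r.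
Qed.

(** In [segment_sum_mulB], the factor x - y and the right-hand side are both
    antisymmetric in x and y. *)
Lemma segment_sum_sym (e : nat -> K) x y lo hi : (lo <= hi)%N ->
  \sum_(lo <= m < hi.+1)
     (\prod_(m <= k < hi) (x - e k.+1)) * \prod_(lo <= k < m) (y - e k)
  = \sum_(lo <= m < hi.+1)
     (\prod_(m <= k < hi) (y - e k.+1)) * \prod_(lo <= k < m) (x - e k).
Proof.
move=> lohi; have [->//|nxy] := eqVneq x y.
have nz : x - y != 0 by rewrite subr_eq0.
apply: (mulfI nz); rewrite segment_sum_mulB // -[x - y]opprB mulNr segment_sum_mulB //.
by rewrite opprB.
Qed.

(** Given the outer partitions d and d'', row i of the middle one ranges over the
    interval from [lo i] to [hi i] whatever the other rows do, so the sum is a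
    product over rows. In row i the boxes of d above [hi i] are forced into the
    first strip and those below [lo i] outside of d'' into the second one.
    The former in row i.+1 and the latter in row i occupy the same interval of
    columns, with the same parameters, so together they contribute a factor
    symmetric in x and y. *)
Lemma two_strips_swap t x y d d'' :
  \sum_(d' | hstrip d d' && hstrip d' d'') strip_wt t x d d' * strip_wt (t + 1) y d' d''
  = \sum_(d' | hstrip d d' && hstrip d' d'') strip_wt t y d d' * strip_wt (t + 1) x d' d''.
Proof.
pose lo i := maxn (dpart d i.+1) (dpart d'' i).
pose hi i := if i is j.+1 then minn (dpart d i) (dpart d'' j) else dpart d 0.
pose e i k := h (t + n%:Z + i%:Z + 1 - k%:Z).
pose G u v (i m : nat) : K := (\prod_(m <= k < dpart d i) (u - e i k.+1))
   * \prod_(dpart d'' i <= k < m) (v - e i k).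
have hiE (i : nat) : (hi i <= dpart d i)%N.
  by case: i => [|i] //=; rewrite geq_minl.
have row (i : nat) u v : \sum_(m < n.+1 | (lo i <= m <= hi i)%N) G u v i m
    = \sum_(lo i <= m < (hi i).+1) G u v i m.
  rewrite [RHS](big_nat_widen _ _ n.+1); last first.
    by rewrite ltnS (leq_trans (hiE i)) ?dpart_le.
  rewrite (big_nat_widenl _ 0) // big_mkord; apply: eq_bigl => m.
  by rewrite ltnS andbC.
have expand u v : \sum_(d' | hstrip d d' && hstrip d' d'')
      strip_wt t u d d' * strip_wt (t + 1) v d' d''
    = \prod_(i < r) \sum_(lo i <= m < (hi i).+1) G u v i m.
  rewrite -(eq_bigr _ (fun (i : 'I_r) _ => row i u v)).
  rewrite bigA_distr_big_dep /=; apply: eq_big => [d'|d' _].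
    apply/andP/forallP => [[/forallP s1 /forallP s2] i|s].
      have := s1 i; have := s2 i; rewrite /in_mem /= /lo dpart_ord.
      move=> /andP[_ a2] /andP[a1 a3]; rewrite geq_max a1 a2 /=.
      case: i {s1} a1 a2 a3 => [[|i] ir] /= a1 a2 a3.
        by rewrite (dpart_ord d (Ordinal ir)).
      have i'r : (i < r)%N by lia.
      have := s2 (Ordinal i'r) => /= /andP[+ _].
      rewrite (dpart_ord d' (Ordinal ir)) (dpart_ord d'' (Ordinal i'r)) => a4.
      by rewrite (dpart_ord d (Ordinal ir)) leq_min a3 a4.
    split; apply/forallP => i; have := s i; rewrite /in_mem /= /lo geq_max dpart_ord.
      by move=> /andP[/andP[-> _] /leq_trans ->] //; rewrite -(dpart_ord d) hiE.
    move=> /andP[/andP[_ ->] _]; rewrite andbT.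
    have [ri|ri] := leqP r i.+1; first by rewrite dpart_out.
    have := s (Ordinal ri); rewrite /in_mem /= leq_min => /andP[_ /andP[_]].
    by rewrite (dpart_ord _ (Ordinal ri)) (dpart_ord _ i).
  rewrite /strip_wt -big_split; apply: eq_bigr => i _; rewrite /G !dpart_ord /=.
  congr (_ * _); apply: eq_bigr => k _; rewrite /e; congr (_ - h _); lia.
rewrite !expand.
(* If the interval of some row is empty, then both sides vanish. *)
have [/existsP[i0 /negPf lohi0]|] := boolP [exists i : 'I_r, ~~ (lo i <= hi i)%N].
  have z u v : \sum_(lo i0 <= m < (hi i0).+1) G u v i0 m = 0.
    by rewrite big_geq // ltnNge lohi0.
  by rewrite (bigD1 i0) // [RHS](bigD1 i0) //= !z !mul0r.
rewrite negb_exists => /forallP lohi.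
have split_row u v (i : 'I_r) : \sum_(lo i <= m < (hi i).+1) G u v i m
   = (\prod_(hi i <= k < dpart d i) (u - e i k.+1)) *
     (\prod_(dpart d'' i <= k < lo i) (v - e i k)) *
     \sum_(lo i <= m < (hi i).+1)
       (\prod_(m <= k < hi i) (u - e i k.+1)) * \prod_(lo i <= k < m) (v - e i k).
  rewrite big_distrr /=; apply: eq_big_nat => m /andP[lom mhi]; rewrite /G.
  rewrite (big_cat_nat (n := hi i) (p := dpart d i)) ?hiE //=.
  rewrite (big_cat_nat (n := lo i) (m := dpart d'' i)) ?leq_maxr //=; ring.
(* The first product gathers the forced boxes, matched between rows i and i.+1;
   no box is forced into the first strip in row 0 or into the second one in row
   r.-1. *)
have main u v : \prod_(i < r) \sum_(lo i <= m < (hi i).+1) G u v i m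
   = (\prod_(i < r.-1) \prod_(dpart d'' i <= k < dpart d i.+1)
        ((u - e i k) * (v - e i k))) *
     \prod_(i < r) \sum_(lo i <= m < (hi i).+1)
       (\prod_(m <= k < hi i) (u - e i k.+1)) * \prod_(lo i <= k < m) (v - e i k).
  under eq_bigr do rewrite split_row.
  rewrite !big_split /=; congr (_ * _).
  rewrite -(big_mkord xpredT (fun i => \prod_(hi i <= k < dpart d i) (u - e i k.+1))).
  rewrite -(big_mkord xpredT (fun i => \prod_(dpart d'' i <= k < lo i) (v - e i k))).
  rewrite -(big_mkord xpredT (fun i => \prod_(dpart d'' i <= k < dpart d i.+1)
        ((u - e i k) * (v - e i k)))).
  have [r0|rpos] := posnP r; first by rewrite r0 !big_geq // mulr1.
  rewrite -[X in index_iota 0 X](prednK rpos).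
  rewrite [X in X * _]big_nat_recl // [X in _ * X]big_nat_recr //=.
  rewrite [X in X * _ * _]big_geq // mul1r [X in _ * (_ * X)]big_geq; last first.
    by rewrite /lo dpart_out ?max0n // prednK.
  rewrite mulr1 -big_split; apply: eq_bigr => i _ /=; rewrite big_split /=.
  congr (_ * _).
    rewrite minnC /minn; case: ltnP => hlt; last by rewrite !big_geq.
    by apply: eq_bigr => k _; rewrite /e; congr (_ - h _); lia.
  rewrite /lo /maxn; case: ltnP => [hlt|//]; by rewrite !big_geq ?(ltnW hlt).
rewrite !main; congr (_ * _).
  by apply: eq_bigr => i _; apply: eq_bigr => k _; rewrite mulrC.
by apply: eq_bigr => i _; apply: segment_sum_sym; have := lohi i; rewrite negbK.
Qed.

Lemma strip_sum_swap x y xs t d : strip_sum (x :: y :: xs) t d = strip_sum (y :: x :: xs) t d.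
Proof.
have expand u v : strip_sum (u :: v :: xs) t d = \sum_d''
    (\sum_(d' | hstrip d d' && hstrip d' d'') strip_wt t u d d' * strip_wt (t + 1) v d' d'')
     * strip_sum xs (t + 1 + 1) d''.
  rewrite /=.
  under eq_bigr do rewrite big_distrr /=.
  rewrite (exchange_big_dep xpredT) //=; apply: eq_bigr => d'' _.
  rewrite big_distrl /=; apply: eq_bigr => d' _; ring.
by rewrite !expand; apply: eq_bigr => d'' _; rewrite two_strips_swap.
Qed.

Lemma strip_sum_front x xs ys t d : strip_sum (xs ++ x :: ys) t d = strip_sum (x :: xs ++ ys) t d.
Proof.
elim: xs t d => // y xs IH t d; rewrite [RHS]strip_sum_swap.
by rewrite cat_cons /=; apply: eq_bigr => d' _; rewrite IH.
Qed.

Lemma prod_nat_last0 (F : nat -> K) a b :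
  (a < b)%N -> F b.-1 = 0 -> \prod_(a <= k < b) F k = 0.
Proof. by case: b => // b ab /= F0; rewrite big_nat_recr //= F0 mulr0. Qed.

(** A nonempty strip removed from the rectangle (n^r) contains box n - 1 of the
    last row, whose factor at time t is x - h (t + r). *)
Lemma strip_sum_top xs t : strip_sum (h (t + r%:Z) :: xs) t dtop = strip_sum xs (t + 1) dtop.
Proof.
rewrite /= (bigD1 dtop) /=; last first.
  apply/forallP => i; rewrite !ffunE leqnn andbT.
  by rewrite dpart_le.
rewrite [X in X * _]big1 => [|i _]; last by rewrite big_geq.
rewrite mul1r [X in _ + X]big1 ?addr0 // => d' /andP[/forallP s nd'].
have [i lt_i] : exists i : 'I_r, (d' i < n)%N.
  apply/existsP; apply: contraNT nd'; rewrite negb_exists => /forallP all.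
  apply/eqP/ffunP => i; apply: val_inj; rewrite ffunE /=.
  by apply/eqP; rewrite eqn_leq -ltnS ltn_ord leqNgt all.
have ri : r = i.+1.
  apply/eqP; rewrite eqn_leq ltn_ord andbT leqNgt; apply: contraL lt_i => lt_i.
  by have := s i; rewrite (dpart_ord _ (Ordinal lt_i)) ffunE -leqNgt => /andP[].
rewrite /strip_wt (bigD1 i) //= ffunE /= prod_nat_last0 ?mul0r //.
by apply/eqP; rewrite subr_eq0; apply/eqP; congr h; lia.
Qed.

(** The symmetry brings each of the last m variables to the front, where it is
    absorbed by [strip_sum_top]. *)
Lemma strip_sum_shift xs t m :
  strip_sum (xs ++ [seq h (t + r%:Z + j%:Z) | j <- iota 0 m]) t dtop = strip_sum xs (t + m%:Z) dtop.
Proof.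
elim: m t => [|m IH] t; first by rewrite cats0 addr0.
rewrite /= strip_sum_front addr0 strip_sum_top.
have -> : t + m.+1%:Z = t + 1 + m%:Z by lia.
rewrite -IH (iotaDl 1 0) -map_comp; congr (strip_sum (_ ++ _) _ _).
by apply: eq_map => j /=; congr h; lia.
Qed.

(** A horizontal strip leaves row i at least as long as row i.+1 was, so it takes
    more than i strips to empty a nonempty row i. *)
Lemma strip_sum_eq0 xs t d i : (size xs <= i)%N -> (0 < dpart d i)%N -> strip_sum xs t d = 0.
Proof.
elim: xs t d i => [|x xs IH] t d i /= le_i d_i.
  case: eqP => // dE; move: d_i; rewrite dE /dpart.
  by case: insub => // u; rewrite ffunE.
case: i le_i d_i => // i le_i d_i.
have ir : (i < r)%N.
  by rewrite ltnNge; apply: contraL d_i => ri; rewrite dpart_out // leqW.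
rewrite big1 // => d' /forallP /(_ (Ordinal ir)) /= /andP[le1 _].
rewrite (IH _ _ i) ?mulr0 //; apply: leq_trans d_i _.
by rewrite (dpart_ord _ (Ordinal ir)).
Qed.

Definition drect m : diag := [ffun i : 'I_r => if (i < m)%N then ord_max else ord0].

Lemma drectE m i : dpart (drect m) i = if (i < r)%N && (i < m)%N then n else 0%N.
Proof.
have [ri|ri] := leqP r i; first by rewrite dpart_out.
by rewrite (dpart_ord _ (Ordinal ri)) ffunE /=; case: ifP.
Qed.

(** With as many steps as nonempty rows, [strip_sum_eq0] forces each step to remove
    exactly the last nonempty row. *)
Lemma strip_sum_rect xs t : (size xs <= r)%N ->
  strip_sum xs t (drect (size xs)) =
    \prod_(x <- xs) \prod_(k < n) (x - h (t + n%:Z + (size xs)%:Z - 1 - k%:Z)).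
Proof.
elim: xs t => [|x xs IH] t le_r.
  by rewrite big_nil /= (_ : drect 0 = dbot) ?eqxx //; apply/ffunP => i; rewrite !ffunE.
set m := size xs; rewrite /= -/m in le_r *.
rewrite (bigD1 (drect m)) /=; last first.
  apply/forallP => i; rewrite -!dpart_ord !drectE ltn_ord !ltnS /=.
  by case: (ltngtP i m); case: (i.+1 < r)%N => //=; rewrite ?leqnn.
rewrite [X in _ + X]big1 ?addr0 => [|d' /andP[/forallP s nd']]; last first.
  rewrite (@strip_sum_eq0 _ _ _ m) ?mulr0 //.
  rewrite (dpart_ord _ (Ordinal le_r)) lt0n; apply: contraNN nd' => d'm.
  apply/eqP/ffunP => i; apply: val_inj; rewrite /= -!dpart_ord drectE ltn_ord /=.
  have := s i; rewrite -!dpart_ord !drectE ltn_ord /= !ltnS.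
  have [im|mi|im] := ltngtP i m; last first.
  - by rewrite im -(dpart_ord d' (Ordinal le_r)) /= in d'm *; rewrite (eqP d'm).
  - by rewrite leqn0 => /andP[_ /eqP->].
  rewrite (leq_ltn_trans im le_r) /= => /andP[le1 le2].
  by apply/eqP; rewrite eqn_leq le1 le2.
rewrite IH ?(ltnW le_r) // big_cons; congr (_ * _); last first.
  apply: eq_bigr => y _; apply: eq_bigr => k _; congr (_ - h _); lia.
rewrite /strip_wt (bigD1 (Ordinal le_r)) //= !ffunE /= ltnn ltnSn /=.
rewrite [X in _ * X]big1 ?mulr1 => [|i im].
  by rewrite big_mkord; apply: eq_bigr => k _; congr (_ - h _); lia.
rewrite !ffunE big_geq // ltnS [(i <= m)%N]leq_eqVlt.
by rewrite (negbTE (im : i != m :> nat)).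
Qed.

End Strips.

(** * Unfolding the recursion into chains of diagonals *)

Section Chains.
Set Implicit Arguments.
Unset Strict Implicit.
Unset Printing Implicit Defensive.
Context (K : fieldType) (r n : nat) (h : int -> K).
Local Notation diag := {ffun 'I_r -> 'I_n.+1}.
Implicit Types (d : diag) (t : int) (xs : seq K) (N : nat).

(** The s-th diagonal of a chain that starts at d; g lists the ones after d. *)
Definition slice N d (g : {ffun 'I_N -> diag}) (s : nat) : diag :=
  if s is s'.+1 then (if insub s' is Some u then g u else dbot r n) else d.
Arguments slice : simpl never.

Definition chain N d (g : {ffun 'I_N -> diag}) : bool :=
  [forall s : 'I_N, hstrip (slice d g s) (slice d g s.+1)]
  && (slice d g N == dbot r n).

Lemma slice_ord N d (g : {ffun 'I_N -> diag}) (s : 'I_N) : slice d g s.+1 = g s.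
Proof. by rewrite /slice valK. Qed.

Lemma strip_sum_chains xs t d : strip_sum h xs t d =
  \sum_(g : {ffun 'I_(size xs) -> diag} | chain d g)
     \prod_(s < size xs) strip_wt h (t + s%:Z) xs`_s (slice d g s) (slice d g s.+1).
Proof.
elim: xs t d => [|x xs IH] t d.
  pose g0 : {ffun 'I_0 -> diag} := [ffun=> d].
  have g0P g : g = g0 by apply/ffunP => -[].
  rewrite (eq_bigr (fun=> 1)) => [|g _]; last by rewrite big_ord0.
  rewrite [LHS]/= big_mkcond (bigD1 g0) //= big1 => [|g]; last by rewrite (g0P g) eqxx.
  rewrite addr0 /chain /=.
  rewrite (_ : [forall s : 'I_0, _] = true) /=; last by apply/forallP => -[].
  by case: ifP.
set N := size xs; rewrite [size _]/= -/N.
pose glue (u : diag * {ffun 'I_N -> diag}) : {ffun 'I_N.+1 -> diag} :=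
  [ffun s : 'I_N.+1 => slice u.1 u.2 s].
pose unglue (g : {ffun 'I_N.+1 -> diag}) : diag * {ffun 'I_N -> diag} :=
  (g ord0, [ffun s => g (lift ord0 s)]).
have glue_slice d' g' s : (s <= N)%N -> slice d (glue (d', g')) s.+1 = slice d' g' s.
  by move=> sN; rewrite (slice_ord _ _ (Ordinal (sN : s < N.+1)%N)) ffunE.
have glueK : cancel glue unglue.
  case=> d' g'; rewrite /unglue ffunE; congr pair; apply/ffunP => s.
  by rewrite !ffunE slice_ord.
have unglueK : cancel unglue glue.
  move=> g; apply/ffunP => s; rewrite ffunE /=.
  case: (unliftP ord0 s) => [s'|] ->; last by [].
  by rewrite slice_ord ffunE.
rewrite [RHS](reindex glue) /=; last by exists unglue => g _.
under [LHS]eq_bigr do rewrite IH big_distrr /=.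
rewrite pair_big_dep /=; apply: eq_big => [[d' g']|[d' g'] _] /=.
  rewrite /chain glue_slice // andbA; congr (_ && _).
  apply/andP/forallP => [[s0 /forallP s1] s|s1].
    case: (unliftP ord0 s) => [s'|] ->; last by rewrite glue_slice.
    by rewrite lift0 !glue_slice ?s1 // ltnW.
  split; first by have := s1 ord0; rewrite glue_slice.
  apply/forallP => s; have := s1 (lift ord0 s).
  by rewrite lift0 !glue_slice // ltnW.
rewrite big_ord_recl addr0 glue_slice //; congr (_ * _).
apply: eq_bigr => s _; rewrite !lift0 !glue_slice //; last exact: ltnW.
by congr (strip_wt _ _ _ _ _); rewrite intS addrA.
Qed.

(** Together with [chain_bot]: in a chain from (n^r) to the empty partition,
    interlacing alone forces the entries outside of the r x c box to be n on its
    left and 0 on its right. *)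
Lemma chain_top N (g : {ffun 'I_N -> diag}) : chain (dtop r n) g ->
  forall s i, (s <= N)%N -> (i + s < r)%N -> dpart (slice (dtop r n) g s) i = n.
Proof.
move=> /andP[/forallP st _]; elim=> [|s IH] i sN isr.
  have ir : (i < r)%N by lia.
  by rewrite (dpart_ord _ (Ordinal ir)) ffunE.
have ir : (i < r)%N by lia.
have /forallP /(_ (Ordinal ir)) /andP[+ _] := st (Ordinal sN).
rewrite IH ?(ltnW sN) ?addSnnS // -dpart_ord => le1.
by apply/eqP; rewrite eqn_leq dpart_le.
Qed.

Lemma chain_bot N (g : {ffun 'I_N -> diag}) d : chain d g ->
  forall s i, (s <= N)%N -> (N - s <= i)%N -> dpart (slice d g s) i = 0%N.
Proof.
move=> /andP[/forallP st /eqP bot] s i; move def_m : (N - s)%N => m.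
elim: m s i def_m => [|m IH] s i def_m sN mi.
  rewrite (_ : s = N); last by lia.
  by rewrite bot /dpart; case: insub => // u; rewrite ffunE.
have [ri|ir] := leqP r i; first exact: dpart_out.
have sN' : (s < N)%N by lia.
case: i mi ir => // i mi ir.
have /forallP /(_ (Ordinal (ltnW ir))) /andP[+ _] := st (Ordinal sN').
rewrite -dpart_ord /= (IH s.+1 i); [|lia..].
by rewrite leqn0 => /eqP.
Qed.

End Chains.

Arguments slice {r n N} d g s : simpl never.

(** * Diagonals of a plane partition *)

Section PlanePartitionDiagonals.
Set Implicit Arguments.
Unset Strict Implicit.
Unset Printing Implicit Defensive.
Context (r c n : nat).
Local Notation diag := {ffun 'I_r -> 'I_n.+1}.
Implicit Types (f : box r c n) (d : diag).

Lemma entry_dec f i j : f \in PP r c n ->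
  (maxn (entry f i.+2 j.+1) (entry f i.+1 j.+2) <= entry f i.+1 j.+1)%N.
Proof.
move=> fPP.
have /PPP [[_ dec] _ _] : exists2 f0, f0 \in PP r c n &
  (forall i j, 0 < i -> 0 < j -> entry f i j = entry f0 i j)%N by exists f.
exact: dec.
Qed.

Lemma entry_col f i j : f \in PP r c n -> (entry f i.+2 j.+1 <= entry f i.+1 j.+1)%N.
Proof. by move=> fPP; have := entry_dec i j fPP; rewrite geq_max => /andP[]. Qed.

Lemma entry_row f i j : f \in PP r c n -> (entry f i.+1 j.+2 <= entry f i.+1 j.+1)%N.
Proof. by move=> fPP; have := entry_dec i j fPP; rewrite geq_max => /andP[]. Qed.

(** Entry i of diagonal s - r of the array (counting i from 0), extended by n to
    the columns of index at most 0. *)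
Definition diagonal f (s i : nat) : nat :=
  if (i + s < r)%N then n else entry f i.+1 (i + s - r).+1.

Lemma diagonal_le f s i : (diagonal f s i <= n)%N.
Proof. by rewrite /diagonal; case: ifP => // _; apply: entry_le. Qed.

Definition diags f : {ffun 'I_(r + c) -> diag} :=
  [ffun s : 'I_(r + c) => [ffun i : 'I_r => inord (diagonal f s.+1 i)]].

Lemma diag_index_lt (x : 'I_r * 'I_c) : (x.2 + (r - x.1) < (r + c).+1)%N.
Proof. by case: x => i j /=; have := ltn_ord i; have := ltn_ord j; lia. Qed.

(** Entry (i, j), counted from 0, lies on diagonal j - i, which has index
    j + (r - i) in the chain. *)
Definition undiags (g : {ffun 'I_(r + c) -> diag}) : box r c n :=
  [ffun x : 'I_r * 'I_c => slice (dtop r n) g (x.2 + (r - x.1)) x.1].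

Lemma slice_diags f s i : (s <= r + c)%N -> (i < r)%N ->
  dpart (slice (dtop r n) (diags f) s) i = diagonal f s i.
Proof.
move=> sN ir; rewrite (dpart_ord _ (Ordinal ir)); case: s sN => [|s] sN.
  by rewrite ffunE /diagonal addn0 ir.
by rewrite (slice_ord _ _ (Ordinal sN)) !ffunE inordK // ltnS diagonal_le.
Qed.

Lemma diagsK : cancel diags undiags.
Proof.
move=> f; apply/ffunP => -[i j]; apply: val_inj; rewrite /= ffunE /=.
have := diag_index_lt (i, j) => /= lt_ij; have ir := ltn_ord i.
rewrite -dpart_ord slice_diags // /diagonal ifF; last by lia.
by rewrite (_ : _ - r = j)%N ?entry_ord; last lia.
Qed.

Lemma undiagsK g : chain (dtop r n) g -> diags (undiags g) = g.
Proof.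
move=> ch; apply/ffunP => s; apply/ffunP => i; apply: val_inj; rewrite /= -!dpart_ord.
rewrite -[in LHS](slice_ord (dtop r n)) slice_diags // -[in RHS](slice_ord (dtop r n)).
have ir := ltn_ord i; have sN := ltn_ord s.
rewrite /diagonal; case: ltnP => [lt_r|le_r]; first by rewrite (chain_top ch).
have [lt_c|le_c] := ltnP (i + s.+1 - r) c.
  rewrite (entry_ord _ i (Ordinal lt_c)) ffunE /= -dpart_ord; congr (dpart (slice _ _ _) _).
  by move: ir sN le_r lt_c; lia.
by rewrite entry_out ?ltnS ?le_c ?orbT // (chain_bot ch) //; lia.
Qed.

(** Comparing horizontal and vertical neighbours in f amounts to interlacing of
    consecutive diagonals. *)
Lemma chain_diags f : chain (dtop r n) (diags f) = (f \in PP r c n).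
Proof.
apply/idP/idP => [/andP[/forallP st _]|fPP].
  rewrite inE; apply/'forall_'forall_idP => i j; rewrite geq_max.
  have ir := ltn_ord i; have jc := ltn_ord j.
  have sN : (j + (r - i) < r + c)%N by lia.
  apply/andP; split.
    have [ri|ir'] := leqP r i.+1; first by rewrite entry_out // ltnS ri.
    have sN' : (j + (r - i.+1) < r + c)%N by lia.
    have /forallP /(_ i) /andP[+ _] := st (Ordinal sN').
    rewrite -!dpart_ord /= !slice_diags ?(ltnW sN') // /diagonal !ifF; try lia.
    by rewrite (_ : _ - r = j)%N 1?(_ : (i + (j + (r - i.+1)).+1 - r = j)%N) //; lia.
  have /forallP /(_ i) /andP[_ +] := st (Ordinal sN).
  rewrite -!dpart_ord /= !slice_diags ?(ltnW sN) // /diagonal !ifF; try lia.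
  by rewrite (_ : _ - r = j.+1)%N 1?(_ : (i + (j + (r - i)) - r = j)%N) //; lia.
apply/andP; split; last first.
  apply/eqP/ffunP => i; apply: val_inj; rewrite /= -dpart_ord slice_diags // ffunE.
  rewrite /diagonal ifF; last by lia.
  by rewrite entry_out //; apply/orP; right; lia.
apply/forallP => s; have sN := ltn_ord s; apply/forallP => i; have ir := ltn_ord i.
rewrite -!dpart_ord (slice_diags f (ltnW sN) ir) (slice_diags f sN ir); apply/andP; split.
  have [ri|ir'] := leqP r i.+1; first by rewrite dpart_out.
  rewrite slice_diags ?(ltnW sN) // /diagonal addSnnS; case: ifP => // _.
  by rewrite entry_col.
rewrite {2}/diagonal; case: ifP => [_|H]; first exact: diagonal_le.
rewrite /diagonal ifF; last by lia.
by rewrite (_ : i + s.+1 - r = (i + s - r).+1)%N ?entry_row //; lia.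
Qed.

Definition rowlen f k i : nat := count (fun j => k <= entry f i j)%N (iota 1 c).

End PlanePartitionDiagonals.

(** A decreasing predicate on the natural numbers holds on an initial segment,
    which is determined by its size. *)
Lemma count_initial (P : pred nat) N : (forall j, P j.+1 -> P j) ->
  (forall j, (N <= j)%N -> ~~ P j) -> forall j, P j = (j < count P (iota 0 N))%N.
Proof.
move=> dec; elim: N => [|N IH] out j; first by rewrite (negbTE (out j _)).
rewrite -[N.+1]addn1 iotaD count_cat /= add0n addn0.
have [PN|nPN] := boolP (P N).
  have PA m i : (i <= m)%N -> P m -> P i.
    elim: m => [|m IHm]; first by rewrite leqn0 => /eqP->.
    by rewrite leq_eqVlt => /orP[/eqP-> //|/IHm + /dec].
  rewrite (eq_in_count (a2 := predT)) ?count_predT ?size_iota ?addn1; last first.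
    by move=> i; rewrite mem_iota => /andP[_ iN]; apply: (PA N) => //; apply: ltnW.
  rewrite ltnS; case: (leqP j N) => [jN|Nj]; first exact: (PA N).
  exact/negbTE/out.
rewrite addn0 IH // => i; rewrite leq_eqVlt => /orP[/eqP<-//|]; exact: out.
Qed.

(** * The polynomial identity *)

Section Numerators.
Set Implicit Arguments.
Unset Strict Implicit.
Unset Printing Implicit Defensive.
Context (K : fieldType) (r c n : nat) (h : int -> K).
Implicit Type f : box r c n.

Lemma rowlenP f k i j : f \in PP r c n -> (0 < k)%N ->
  (k <= entry f i.+1 j.+1)%N = (j < rowlen f k i.+1)%N.
Proof.
move=> fPP k0; rewrite /rowlen (iotaDl 1 0) count_map.
apply: (@count_initial (fun j => k <= entry f i.+1 j.+1)%N c _ _ j) => [m km|m cm].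
  exact: leq_trans km (entry_row _ _ fPP).
by rewrite entry_out ?ltnS ?cm ?orbT // -ltnNge.
Qed.

Lemma rowlen_le f k i : (rowlen f k i <= c)%N.
Proof. by rewrite -[leqRHS](size_iota 1) count_size. Qed.

(** Counting from 1, box k of row i disappears between diagonals t and t + 1
    precisely for t = l - i, where l is the length of row i of the level set of f
    at k. *)
Lemma prod_strip_wt_diags f : f \in PP r c n ->
  \prod_(s < r + c) strip_wt h (- r%:Z + s%:Z) (h (- r%:Z + s%:Z))
     (slice (dtop r n) (diags f) s) (slice (dtop r n) (diags f) s.+1)
  = \prod_(i < r) \prod_(k < n)
      (h ((rowlen f k.+1 i.+1)%:Z - i.+1%:Z)
       - h ((rowlen f k.+1 i.+1)%:Z + n%:Z - k.+1%:Z)).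
Proof.
move=> fPP; rewrite /strip_wt exchange_big; apply: eq_bigr => i _ /=.
have ir := ltn_ord i.
under eq_bigr => s _.
  rewrite (big_nat_widen _ _ n); last by rewrite -ltnS.
  rewrite (big_nat_widenl _ 0) // big_mkord big_mkcond /=.
  rewrite -!dpart_ord !slice_diags //; last exact: ltnW.
  over.
rewrite exchange_big; apply: eq_bigr => k _ /=.
set l := rowlen f k.+1 i.+1.
have lc : (l <= c)%N := rowlen_le _ _ _.
have sig : (l + r - i.+1 < r + c)%N by lia.
have kn := ltn_ord k.
have mem s : (k < diagonal f s i)%N = (i + s < r + l)%N.
  rewrite /diagonal; have [H|H] := ltnP (i + s) r; first by rewrite kn; lia.
  by rewrite rowlenP // -/l; lia.
rewrite (bigD1 (Ordinal sig)) //= big1 ?mulr1 => [|s ns]; last first.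
  rewrite [(_ <= k)%N]leqNgt !mem; case: ifP => // /andP[H1 H2].
  case/eqP: ns; apply: val_inj => /=; lia.
rewrite [(_ <= k)%N]leqNgt !mem ifT; last by lia.
by congr (h _ - h _); lia.
Qed.

(** The left-hand side is [strip_sum] of (n^r) at the variables h t, - r <= t < c,
    starting at time - r: [strip_sum_shift] absorbs those with t >= 0 and
    [strip_sum_rect] evaluates the rest. *)
Theorem sum_numerators :
  \sum_(f in PP r c n) \prod_(i < r) \prod_(k < n)
      (h ((rowlen f k.+1 i.+1)%:Z - i.+1%:Z)
       - h ((rowlen f k.+1 i.+1)%:Z + n%:Z - k.+1%:Z))
  = \prod_(i < r) \prod_(k < n) (h (- i.+1%:Z) - h (c%:Z + k%:Z)).
Proof.
pose xs := [seq h (- r%:Z + s%:Z) | s <- iota 0 (r + c)].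
have size_xs : size xs = (r + c)%N by rewrite size_map size_iota.
transitivity (strip_sum h xs (- r%:Z) (dtop r n)).
  rewrite strip_sum_chains size_xs (reindex_onto (@diags r c n) (@undiags r c n)) => [|g ch]; last first.
    exact: undiagsK.
  apply: eq_big => f; first by rewrite chain_diags diagsK eqxx andbT.
  move=> fPP; rewrite -prod_strip_wt_diags //; apply: eq_bigr => s _.
  by rewrite (nth_map 0%N) ?size_iota // nth_iota.
rewrite /xs iotaD map_cat add0n -[X in iota X c]addn0 iotaDl -map_comp.
rewrite (_ : [seq _ | j <- iota 0 c]
  = [seq h (- r%:Z + r%:Z + j%:Z) | j <- iota 0 c]); last first.
  by apply: eq_map => j /=; congr h; lia.
rewrite strip_sum_shift.
set ys := [seq _ | s <- iota 0 r].
have sz : size ys = r by rewrite size_map size_iota.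
have -> : dtop r n = drect r n (size ys).
  by apply/ffunP => i; rewrite !ffunE sz ltn_ord.
rewrite strip_sum_rect sz // big_map -[r in iota 0 r]subn0 -/(index_iota 0 r).
rewrite big_mkord (reindex_inj rev_ord_inj); apply: eq_bigr => i _.
rewrite (reindex_inj rev_ord_inj); apply: eq_bigr => k _ /=.
by have ir := ltn_ord i; have kn := ltn_ord k; congr (h _ - h _); lia.
Qed.

End Numerators.

(** * The summand in terms of the potential *)

Section Weights.
Set Implicit Arguments.
Unset Strict Implicit.
Unset Printing Implicit Defensive.
Context (K : fieldType) (a : K) (p q : int -> K).
Context (a0 : a != 0) (p0 : forall i, p i != 0) (q0 : forall j, q j != 0).
Context (generic : forall i m : nat, a * bipow p i%:Z * bipow q m%:Z != 1).

(** The potential whose ratios pot t / pot (t - 1) are p_(-t), a and q_t according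
    to the sign of t. *)
Definition pot (m : int) : K :=
  match m with
  | Posz m => bipow q m%:Z
  | Negz m => (a * bipow p m%:Z)^-1
  end.
Arguments pot : simpl never.

Lemma bipow_neq0 (x : int -> K) (m : nat) : (forall k, x k != 0) -> bipow x m%:Z != 0.
Proof.
by move=> x0 /=; elim/big_rec: _ => [|k y _ y0]; rewrite ?oner_neq0 ?mulf_neq0.
Qed.

Lemma pot_neq0 m : pot m != 0.
Proof.
by case: m => m; rewrite /pot ?invr_eq0 ?mulf_neq0 //; apply: bipow_neq0.
Qed.

Lemma pot_neg i : pot (- i.+1%:Z) = (a * bipow p i%:Z)^-1.
Proof. by []. Qed.

Lemma pot_ratio (i m : nat) : a * bipow p i%:Z * bipow q m%:Z = pot m / pot (- i.+1%:Z).
Proof. by rewrite pot_neg invrK mulrC. Qed.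

(** Up to a factor pot (- i.+1), every denominator 1 - a p_1 ... p_i q_1 ... q_m is
    such a difference. *)
Lemma pot_sub_neq0 (i m : nat) : pot (- i.+1%:Z) - pot m != 0.
Proof.
rewrite subr_eq0; apply: contraNneq (generic i m) => e.
by rewrite pot_ratio e divff ?pot_neq0.
Qed.

Lemma bipowS (x : int -> K) (m : nat) : bipow x m.+1%:Z = bipow x m%:Z * x m.+1%:Z.
Proof. by rewrite /= big_nat_recr. Qed.

Lemma bipow_shift (x : int -> K) (m u : nat) :
  bipow x (m + u)%N%:Z = bipow x m%:Z * bipow (bishift m%:Z x) u%:Z.
Proof.
elim: u => [|u IH]; first by rewrite addn0 /= [X in _ * X]big_geq // mulr1.
by rewrite addnS !bipowS IH mulrA /bishift -PoszD addnS.
Qed.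

Definition content_wt (t : int) : K := pot t / pot (t - 1).

Lemma content_wt0 : content_wt 0 = a.
Proof.
rewrite /content_wt (_ : 0 - 1 = - 1%:Z :> int) ?sub0r // pot_neg invrK.
by rewrite /pot /bipow /= [X in X * _]big_geq // mul1r big_geq // mulr1.
Qed.

Lemma content_wt_pos (m : nat) : (0 < m)%N -> content_wt m%:Z = q m%:Z.
Proof.
case: m => // m _; rewrite /content_wt (_ : m.+1%:Z - 1 = m%:Z); last by lia.
by rewrite /pot bipowS mulrAC divff ?mul1r // bipow_neq0.
Qed.

Lemma content_wt_neg (m : nat) : (0 < m)%N -> content_wt (- m%:Z) = p m%:Z.
Proof.
case: m => // m _; rewrite /content_wt (_ : - m.+1%:Z - 1 = - m.+2%:Z); last by lia.
rewrite !pot_neg invrK bipowS [a * (_ * _)]mulrA mulKf // mulf_neq0 //; exact: bipow_neq0.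
Qed.

Lemma prod_pick (F : nat -> K) (P : pred nat) m n u : P =1 pred1 u ->
  \prod_(m <= l < n) (if P l then F l else 1) = if (m <= u < n)%N then F u else 1.
Proof.
by move=> PE; rewrite -big_mkcond (eq_bigl (pred1 u)) // big_nat1_eq.
Qed.

Section Box.
Context (r c n : nat).
Implicit Type f : box r c n.

Lemma expr_tr (x : K) l f : x ^+ tr l f =
  \prod_(i < r) \prod_(j < c)
    (if j%:Z - i%:Z == l then x ^+ entry f i.+1 j.+1 else 1).
Proof.
rewrite /tr -prodrXr big_add1 big_mkord; apply: eq_bigr => i _.
rewrite -prodrXr big_add1 big_mkord big_mkcond; apply: eq_bigr => j _ /=.
by rewrite (_ : j.+1%:Z - i.+1%:Z = j%:Z - i%:Z) //; lia.
Qed.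

Lemma monomial_content f :
  a ^+ tr 0 f * (\prod_(1 <= i < r) p i%:Z ^+ tr (- i%:Z) f)
     * (\prod_(1 <= j < c) q j%:Z ^+ tr j%:Z f)
  = \prod_(i < r) \prod_(j < c) content_wt (j%:Z - i%:Z) ^+ entry f i.+1 j.+1.
Proof.
rewrite expr_tr.
under [X in _ * X * _]eq_bigr do rewrite expr_tr.
under [X in _ * X]eq_bigr do rewrite expr_tr.
rewrite [X in _ * X * _]exchange_big [X in _ * X]exchange_big -!big_split.
apply: eq_bigr => i _ /=.
rewrite [X in _ * X * _]exchange_big [X in _ * X]exchange_big -!big_split.
apply: eq_bigr => j _ /=.
have ir := ltn_ord i; have jc := ltn_ord j.
have [ij|ji|<-] := ltngtP i j.
- rewrite ifF; last by lia.
  rewrite big1 => [|l _]; last by rewrite ifF //; lia.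
  rewrite !mul1r (prod_pick _ _ _ (u := (j - i)%N)) => [|l /=]; last by lia.
  rewrite ifT; last by lia.
  by rewrite -content_wt_pos ?subn_gt0 // (_ : (j - i)%N%:Z = j%:Z - i%:Z) //; lia.
- rewrite ifF; last by lia.
  rewrite [X in _ * X]big1_seq => [|l]; last first.
    by rewrite mem_index_iota => H; rewrite ifF //; lia.
  rewrite mulr1 mul1r (prod_pick _ _ _ (u := (i - j)%N)) => [|l /=]; last by lia.
  rewrite ifT; last by lia.
  by rewrite -content_wt_neg ?subn_gt0 // (_ : - (i - j)%N%:Z = j%:Z - i%:Z) //; lia.
rewrite subrr eqxx content_wt0 !big1_seq ?mulr1 // => l; rewrite mem_index_iota => H.
  by rewrite ifF //; lia.
by rewrite ifF //; lia.
Qed.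

(** Cut f into its level sets: each row of a level set is a run of consecutive
    contents starting at 1 - i, so the potentials telescope. *)
Lemma prod_content f : f \in PP r c n ->
  \prod_(i < r) \prod_(j < c) content_wt (j%:Z - i%:Z) ^+ entry f i.+1 j.+1
  = \prod_(i < r) \prod_(k < n)
      (pot ((rowlen f k.+1 i.+1)%:Z - i.+1%:Z) / pot (- i.+1%:Z)).
Proof.
move=> fPP; apply: eq_bigr => i _.
under eq_bigr => j _.
  rewrite -[entry _ _ _]subn0 -prodr_const_nat (big_nat_widen _ _ n) ?entry_le // big_mkord big_mkcond /=.
  under eq_bigr => k _ do rewrite (rowlenP _ _ fPP) //.
  over.
rewrite exchange_big; apply: eq_bigr => k _ /=; rewrite -big_mkcond /=.
set l := rowlen _ _ _.
have lc : (l <= c)%N := rowlen_le _ _ _.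
rewrite -(big_mkord (fun j => j < l)%N (fun j => content_wt (j%:Z - i%:Z))).
rewrite -(big_nat_widen 0 l c xpredT) //.
have [l0|l_gt0] := posnP l; first by rewrite l0 big_geq // sub0r divff ?pot_neq0.
rewrite (telescope_prodf_eq (fun j => pot (j%:Z - i.+1%:Z))) ?sub0r // => j _.
  exact: pot_neq0.
by rewrite /content_wt; congr (pot _ / pot _); lia.
Qed.

Lemma part_lam f k i : part (lam k f) i.+1 = if (i < r)%N then rowlen f k i.+1 else 0%N.
Proof.
rewrite /part /lam; case: ltnP => ir.
  by rewrite (nth_map 0%N) ?size_iota // nth_iota.
by rewrite nth_default // size_map size_iota.
Qed.

Lemma rowlen_dec f k i : f \in PP r c n -> (rowlen f k i.+2 <= rowlen f k i.+1)%N.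
Proof.
move=> fPP; apply: sub_count => -[|j] //= /leq_trans; apply; exact: entry_col.
Qed.

(** Row lengths decrease, so the rows counted by the Durfee square are the first
    ones. *)
Lemma durfeeP f k i : f \in PP r c n -> (i < r)%N ->
  (i < durfee (lam k f))%N = (i < rowlen f k i.+1)%N.
Proof.
move=> fPP ir; rewrite /durfee (iotaDl 1 0) count_map.
rewrite (_ : size _ = r); last by rewrite size_map size_iota.
rewrite -(@count_initial (fun i => i < part (lam k f) i.+1)%N).
- by rewrite part_lam ir.
- move=> j; rewrite !part_lam; case: (ltnP j.+1 r) => // jr.
  by rewrite (ltnW jr) => H; apply: leq_trans (rowlen_dec _ _ fPP); apply: ltnW.
- by move=> j rj; rewrite part_lam [(j < r)%N]ltnNge rj.
Qed.

Lemma durfee_le f k : (durfee (lam k f) <= r)%N.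
Proof.
by rewrite /durfee (leq_trans (count_size _ _)) // size_iota size_map size_iota.
Qed.

(** In a row of length l >= i both potentials are rising powers of q, and their
    ratio is a shifted one; for l < i the lower potential has a negative index,
    which brings in a and a rising power of p. The levels k above the largest
    part contribute 1, as all the rows are then empty. *)
Lemma omega_pot f : f \in PP r c n -> omega f a p q =
  \prod_(i < r) \prod_(k < n)
    ((1 - pot ((rowlen f k.+1 i.+1)%:Z + n%:Z - k.+1%:Z)
          / pot ((rowlen f k.+1 i.+1)%:Z - i.+1%:Z))
     / (1 - pot (n%:Z - k.+1%:Z) / pot (- i.+1%:Z))).
Proof.
move=> fPP; rewrite exchange_big /omega big_add1 /=.
have e11 : (entry f 1 1 <= n)%N by exact: entry_le.
rewrite (big_nat_widen _ _ n) // big_mkord big_mkcond; apply: eq_bigr => k _ /=.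
have kn := ltn_ord k.
have nkE : n%:Z - k.+1%:Z = (n - k.+1)%N%:Z by lia.
have den0 i : 1 - pot (n%:Z - k.+1%:Z) / pot (- i.+1%:Z) != 0.
  by rewrite nkE -pot_ratio subr_eq0 eq_sym generic.
case: ltnP => [_|le_k]; last first.
  rewrite big1 // => i _.
  have -> : rowlen f k.+1 i.+1 = 0%N.
    apply/eqP; rewrite -leqn0 leqNgt -rowlenP // -ltnNge ltnS.
    apply: leq_trans le_k; elim: (nat_of_ord i) => // m; apply: leq_trans.
    exact: entry_col.
  by rewrite add0r sub0r divff.
rewrite big_split /=; congr (_ * _); last first.
  rewrite -prodfV big_add1 big_mkord; apply: eq_bigr => i _; congr (_^-1).
  by rewrite nkE (_ : i.+1%:Z - 1 = i%:Z) ?pot_ratio //; lia.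
set D := durfee _; have Dr : (D <= r)%N by exact: durfee_le.
rewrite -(big_mkord xpredT (fun i => 1 - pot ((rowlen f k.+1 i.+1)%:Z + n%:Z - k.+1%:Z)
          / pot ((rowlen f k.+1 i.+1)%:Z - i.+1%:Z))).
rewrite (big_cat_nat _ Dr) //= !big_add1 /=; congr (_ * _); apply: eq_big_nat => i.
  move=> /andP[_ iD]; have ir : (i < r)%N by lia.
  rewrite part_lam ir; have := durfeeP k.+1 fPP ir; rewrite iD => /esym.
  set l := rowlen _ _ _ => il.
  rewrite (_ : l%:Z - i.+1%:Z = (l - i.+1)%N%:Z); last by lia.
  rewrite (_ : n%:Z - k.+1%:Z + i.+1%:Z = (n - k.+1 + i.+1)%N%:Z); last by lia.
  rewrite (_ : l%:Z + n%:Z - k.+1%:Z = (l - i.+1 + (n - k.+1 + i.+1))%N%:Z); last by lia.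
  by rewrite [in RHS]/pot (bipow_shift q) [X in X / _]mulrC mulfK // bipow_neq0.
move=> /andP[Di ir]; rewrite part_lam ir.
have := durfeeP k.+1 fPP ir; rewrite ltnNge Di => /esym/negbT; rewrite -leqNgt.
set l := rowlen _ _ _ => il.
rewrite (_ : i.+1%:Z - l%:Z - 1 = (i - l)%N%:Z); last by lia.
rewrite (_ : n%:Z - k.+1%:Z + l%:Z = (l + (n - k.+1))%N%:Z); last by lia.
rewrite (_ : l%:Z + n%:Z - k.+1%:Z = (l + (n - k.+1))%N%:Z); last by lia.
by rewrite pot_ratio (_ : l%:Z - i.+1%:Z = - (i - l).+1%:Z) //; lia.
Qed.

Lemma weight_pot f : f \in PP r c n ->
  a ^+ tr 0 f * (\prod_(1 <= i < r) p i%:Z ^+ tr (- i%:Z) f)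
     * (\prod_(1 <= j < c) q j%:Z ^+ tr j%:Z f) * omega f a p q
  = (\prod_(i < r) \prod_(k < n)
      (pot ((rowlen f k.+1 i.+1)%:Z - i.+1%:Z)
       - pot ((rowlen f k.+1 i.+1)%:Z + n%:Z - k.+1%:Z)))
    / \prod_(i < r) \prod_(k < n) (pot (- i.+1%:Z) - pot k%:Z).
Proof.
move=> fPP; rewrite monomial_content prod_content // omega_pot //.
rewrite -big_split -prodf_div; apply: eq_bigr => i _ /=.
rewrite [X in _ / X](reindex_inj rev_ord_inj) -big_split -prodf_div.
apply: eq_bigr => k _ /=; have kn := ltn_ord k.
set l := rowlen _ _ _; rewrite (_ : n%:Z - k.+1%:Z = (n - k.+1)%N%:Z); last by lia.
have z0 m : pot m != 0 := pot_neq0 m.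
have := pot_sub_neq0 i (n - k.+1); have := z0 (- i.+1%:Z).
have := z0 (l%:Z - i.+1%:Z).
move: (pot (l%:Z - i.+1%:Z)) (pot (- i.+1%:Z)) (pot (l%:Z + n%:Z - k.+1%:Z))
  (pot (n - k.+1)%N%:Z) => u v w x u0 v0 vx0.
by field; rewrite ?u0 ?v0 ?vx0.
Qed.

End Box.

(** The product over j of the right-hand side telescopes, which leaves
    [sum_numerators] over the common denominator. *)
Theorem sum_weights (r c n : nat) :
  \sum_(f in PP r c n)
     a ^+ tr 0 f * (\prod_(1 <= i < r) p i%:Z ^+ tr (- i%:Z) f)
     * (\prod_(1 <= j < c) q j%:Z ^+ tr j%:Z f) * omega f a p q
  = \prod_(0 <= i < r) \prod_(0 <= j < c) \prod_(0 <= k < n)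
      ((1 - a * bipow p i%:Z * bipow q (j%:Z + k%:Z + 1))
       / (1 - a * bipow p i%:Z * bipow q (j%:Z + k%:Z))).
Proof.
rewrite (eq_bigr _ (fun f fPP => weight_pot (f := f) fPP)).
rewrite -mulr_suml sum_numerators -prodf_div big_mkord.
apply: eq_bigr => i _; rewrite -prodf_div exchange_big big_mkord.
apply: eq_bigr => k _.
have g0 m : 1 - a * bipow p i%:Z * bipow q m%:Z != 0.
  by rewrite subr_eq0 eq_sym generic.
have [->|c_gt0] := posnP c.
  by rewrite big_geq // add0r divff // pot_sub_neq0.
rewrite (telescope_prodf_eq (fun j => 1 - a * bipow p i%:Z * bipow q (j + k)%N%:Z)) //.
  rewrite add0n !pot_ratio -PoszD.
  have := pot_sub_neq0 i k; have := pot_neq0 (- i.+1%:Z).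
  move: (pot (- i.+1%:Z)) (pot (c + k)%N%:Z) (pot k%:Z) => u v w u0 uw0.
  by field; rewrite ?u0 ?uw0.
by move=> j _; rewrite -!PoszD addSn addn1.
Qed.

End Weights.

(** * Genericity of the indeterminates *)

Section Indeterminates.
Set Implicit Arguments.
Unset Strict Implicit.
Unset Printing Implicit Defensive.
Context (F : fieldType).

Definition monomial (m : {cmonom indet}) : ratfun F :=
  FracField.tofrac (<< m >> : {malg F[{cmonom indet}]}).

Lemma monomial1 : monomial mone = 1.
Proof. by rewrite /monomial -[RHS]tofrac1 -[in RHS]mpolyC1E. Qed.

Lemma monomialM m1 m2 : monomial (mmul m1 m2) = monomial m1 * monomial m2.
Proof. by rewrite /monomial -tofracM [X in _ = tofrac X]fgmulUU mulr1. Qed.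

Lemma monomial_inj : injective monomial.
Proof.
move=> m1 m2 /eqP; rewrite tofrac_eq => /eqP e.
have [//|/negPf ne] := eqVneq m1 m2.
have e1 : (<< m1 >> : {malg F[{cmonom indet}]})@_m2 = 0.
  by rewrite (mcoeffU1 F m1 m2) ne.
have e2 : (<< m1 >> : {malg F[{cmonom indet}]})@_m2
    = (<< m2 >> : {malg F[{cmonom indet}]})@_m2 by exact: congr1 e.
have e3 := etrans (esym e1) e2; rewrite (mcoeffUU m2 1) in e3.
by have := oner_neq0 F; rewrite -e3 eqxx.
Qed.

Lemma monomial_neq0 m : monomial m != 0.
Proof. by rewrite /monomial tofrac_eq0 monalgU_eq0 oner_eq0. Qed.

Lemma bipow_monomial (v : int -> indet) (m : nat) :
  exists e, bipow (fun k => ind F (v k)) m%:Z = monomial e.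
Proof.
elim: m => [|m [e IH]]; first by exists mone; rewrite monomial1 /= big_geq.
by exists (mmul e (ucm (v m.+1%:Z))); rewrite bipowS IH monomialM.
Qed.

Lemma ind_neq0 x : ind F x != 0.
Proof. exact: (monomial_neq0 (ucm x)). Qed.

(** This is a monomial divisible by a, hence not 1. *)
Lemma ind_generic (i m : nat) :
  ind F IndA * bipow (fun k => ind F (IndP k)) i%:Z
    * bipow (fun k => ind F (IndQ k)) m%:Z != 1.
Proof.
have [e1 E1] := bipow_monomial IndP i; have [e2 E2] := bipow_monomial IndQ m.
pose e := mmul (mmul (ucm IndA) e1) e2.
have Ee : monomial e = ind F IndA * monomial e1 * monomial e2.
  exact: etrans (monomialM _ _) (congr1 (fun z => z * monomial e2) (monomialM _ _)).
have -> := etrans (congr2 _ (congr2 _ erefl E1) E2) (esym Ee).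
apply/eqP => /(fun E => etrans E (esym monomial1)) /monomial_inj /eqP.
by rewrite !cmM_eq1 cm1_eq1.
Qed.

End Indeterminates.

Theorem theorem17 (R : realType) (r c n : nat) :
  let K : fieldType := ratfun R[i] in
  let a : K := ind R[i] IndA in
  let p : int -> K := fun i => ind R[i] (IndP i) in
  let q : int -> K := fun j => ind R[i] (IndQ j) in
  \sum_(pi in PP r c n)
     a ^+ tr 0 pi
     * (\prod_(1 <= i < r) p i%:Z ^+ tr (- i%:Z) pi)
     * (\prod_(1 <= j < c) q j%:Z ^+ tr j%:Z pi)
     * omega pi a p q
  = \prod_(0 <= i < r) \prod_(0 <= j < c) \prod_(0 <= k < n)
      ((1 - a * bipow p i%:Z * bipow q (j%:Z + k%:Z + 1))
       / (1 - a * bipow p i%:Z * bipow q (j%:Z + k%:Z))).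
Proof.
exact: (sum_weights (ind_neq0 _ _) (fun i => ind_neq0 _ (IndP i))
  (fun j => ind_neq0 _ (IndQ j)) (ind_generic R[i])).
Qed.
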